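(* Let $q\ge1$ and let $i_1,\dots,i_q$ be integers with $1\le i_1<\cdots<i_q\le 5$. Then there exists a $7$-dimensional integral polytope $\mathcal{P}$ such that the coefficients of $t^{i_1},\dots,t^{i_q}$ in $i(\mathcal{P},t)$ are negative, and all the remaining coefficients of $i(\mathcal{P},t)$ are positive.
   Context: An integral polytope is a convex polytope all of whose vertices have integer coordinates. For an integral polytope $\mathcal{P}\subseteq\mathbb{R}^N$ of dimension $d$, $i(\mathcal{P},t)=|t\mathcal{P}\cap\mathbb{Z}^N|$ ($t$ a positive integer) is a polynomial in $t$ of degree $d$, the Ehrhart polynomial. *)

(* Defs.v *)
From mathcomp Require Import all_boot all_order all_algebra.
From mathcomp Require Import all_classical all_reals.

Set Implicit Arguments.
Unset Strict Implicit.
Unset Printing Implicit Defensive.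

Import Order.TTheory GRing.Theory Num.Theory.
Local Open Scope classical_set_scope.
Local Open Scope ring_scope.

Section IntegralPolytopes.
Variables (R : realType) (N : nat).
Implicit Types (A P : set 'rV[R]_N) (d t : nat) (p : {poly R}).

Definition convex_hull A : set 'rV[R]_N :=
  [set x | exists n (v : 'I_n -> 'rV[R]_N) (w : 'I_n -> R),
    [/\ forall k, A (v k), forall k, 0 <= w k,
        \sum_k w k = 1 & x = \sum_k w k *: v k]].

Definition affine_hull A : set 'rV[R]_N :=
  [set x | exists n (v : 'I_n -> 'rV[R]_N) (w : 'I_n -> R),
    [/\ forall k, A (v k), \sum_k w k = 1 & x = \sum_k w k *: v k]].

Definition convex_polytope P : Prop :=
  exists2 A, finite_set A & P = convex_hull A.

(* The vertices of a polytope are its extreme points. *)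
Definition vertex P (v : 'rV[R]_N) : Prop :=
  P v /\ forall (x y : 'rV[R]_N) (a : R), P x -> P y -> 0 < a < 1 ->
    v = a *: x + (1 - a) *: y -> x = v /\ y = v.

Definition integer_points : set 'rV[R]_N :=
  [set x | x \is a mxOver (Num.int : {pred R})].

Definition integral_polytope P : Prop :=
  convex_polytope P /\ vertex P `<=` integer_points.

(* The affine hull is a translate of a linear subspace of dimension d; the
   empty set has no dimension in this sense. *)
Definition has_dim P d : Prop :=
  exists (x : 'rV[R]_N) (V : {vspace 'rV[R]_N}),
    affine_hull P = [set x + v | v in [set` V]] /\ \dim V = d.

Definition dilate t P : set 'rV[R]_N := [set t%:R *: x | x in P].

(* p is the polynomial of degree d whose value at each t > 0 is the number of
   integer points of tP (in particular there are finitely many of them). *)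
Definition ehrhart_polynomial P d p : Prop :=
  size p = d.+1 /\
  forall t, (0 < t)%N -> exists2 n : nat,
    (dilate t P `&` integer_points #= `I_n)%card & p.[t%:R] = n%:R.

End IntegralPolytopes.

(* Main.v *)
(* Ehrhart polynomials multiply under products, and replacing P by nP replaces t
   by nt.  For each of the 32 sign patterns we take the product of a dilated Reeve
   tetrahedron and a dilated 4-dimensional simplex.  Both are simplices with
   vertices 0, e_1, ..., e_(d-1) and (m, -b_1, ..., -b_(d-1)): the fractional parts
   of the barycentric coordinates of a lattice point of the t-th dilate depend only
   on its first coordinate modulo m, and their integral parts are arbitrary natural
   numbers of bounded sum, so that the Ehrhart polynomial is the sum over j < m of
   the binomial coefficients (t + d - h_j choose d), where h_j is the rounded-up
   sum of the fractional parts in the class j.  The signs of the coefficients are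
   then a finite computation with integers. *)

Require Import Defs.
From Stdlib Require Import ZArith.
From mathcomp Require Import all_boot all_order all_algebra finmap.
From mathcomp Require Import all_classical all_reals.
From mathcomp Require Import ring zify ssrZ.

Import Order.TTheory GRing.Theory Num.Theory.
Local Open Scope classical_set_scope.
Local Open Scope ring_scope.

(** * Convex and affine hulls, extreme points *)

Section Hulls.
Variables (R : realType) (N : nat).
Implicit Types (A : set 'rV[R]_N) (x y : 'rV[R]_N).

Lemma convex_hull_fin {A} {I : finType} {v : I -> 'rV[R]_N} {w : I -> R} :
  (forall i, A (v i)) -> (forall i, 0 <= w i) -> \sum_i w i = 1 ->
  convex_hull A (\sum_i w i *: v i).
Proof.
move=> Av w0 w1; exists #|I|, (v \o enum_val), (w \o enum_val).
have bij := onW_bij predT (@enum_val_bij I).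
by split=> [k|k||] //=; rewrite ?(reindex _ bij) // -w1 (reindex _ bij).
Qed.

Lemma affine_hull_fin {A} {I : finType} {v : I -> 'rV[R]_N} {w : I -> R} :
  (forall i, A (v i)) -> \sum_i w i = 1 -> affine_hull A (\sum_i w i *: v i).
Proof.
move=> Av w1; exists #|I|, (v \o enum_val), (w \o enum_val).
have bij := onW_bij predT (@enum_val_bij I).
by split=> [k||] //=; rewrite ?(reindex _ bij) // -w1 (reindex _ bij).
Qed.

Lemma convex_hull_sub A : A `<=` convex_hull A.
Proof.
move=> x Ax; have := @convex_hull_fin A 'I_1 (fun=> x) (fun=> 1).
by rewrite !big_ord1 scale1r; exact.
Qed.

Lemma affine_hullS A B : A `<=` B -> affine_hull A `<=` affine_hull B.
Proof.
by move=> AB x [n [v [w [Av w1 ->]]]]; exists n, v, w; split=> // k; exact: AB.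
Qed.

(** A point [v k] of positive weight is either the whole combination or one end of a proper segment
    through [x], whose other end is the renormalised rest; in the second case extremality forces
    [v k = x]. *)
Lemma vertex_convex_hull A : vertex (convex_hull A) `<=` A.
Proof.
move=> x [[n [v [w [Av w0 w1 xE]]]] ext].
have [k wk_gt0] : exists k, 0 < w k.
  apply: contrapT => H; move: w1; rewrite big1 => [/eqP|k _].
    by rewrite eq_sym oner_eq0.
  apply/eqP; rewrite eq_le w0 andbT leNgt; apply/negP => wk; apply: H.
  by exists k.
have sumE : \sum_(l | l != k) w l = 1 - w k.
  by apply/eqP; rewrite eq_sym subr_eq -w1 [\sum_i w i](bigD1 k) //= addrC.
have [wk1|wk1] := eqVneq (w k) 1.
  have w0' l : l != k -> w l = 0.
    by move=> lk; move: sumE; rewrite wk1 subrr => /psumr_eq0P -> // i _.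
  by rewrite xE (bigD1 k) //= wk1 scale1r big1 ?addr0 // => l /w0' ->; rewrite scale0r.
have wk_lt1 : 0 < 1 - w k.
  by rewrite -sumE lt_def sumr_ge0 // andbT sumE subr_eq0 eq_sym.
pose w' l := if l == k then 0 else w l / (1 - w k).
have Py : convex_hull A (\sum_l w' l *: v l).
  apply: convex_hull_fin => // [l|].
    by rewrite /w'; case: ifP => // _; rewrite divr_ge0 // ltW.
  rewrite (bigD1 k) //= {1}/w' eqxx add0r.
  under eq_bigr => l lk do rewrite /w' (negPf lk).
  by rewrite -mulr_suml sumE divff // gt_eqF.
have [||<- _ //] := ext _ _ (w k) (convex_hull_sub A (v k) (Av k)) Py.
  by rewrite wk_gt0 -subr_gt0.
rewrite xE (bigD1 k) //= [in RHS](bigD1 k) //= {1}/w' eqxx scale0r add0r scaler_sumr.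
congr (_ + _); apply: eq_bigr => l lk; rewrite /w' (negPf lk) scalerA mulrCA.
by rewrite divff ?mulr1 // gt_eqF.
Qed.

End Hulls.

(** * Full-dimensional lattice polytopes, their dilates and products *)

(** Full dimension is encoded by an affine hull equal to the whole space. The degree of [p] is left
    out here and determined only once, for the final product. *)
Definition full_lattice_polytope {R : realType} {N : nat} (P : set 'rV[R]_N)
    (p : {poly R}) : Prop :=
  [/\ exists A, [/\ finite_set A, A `<=` @integer_points R N,
        affine_hull A = setT & P = convex_hull A]
    & forall t, (0 < t)%N -> exists2 n : nat,
        (dilate t P `&` @integer_points R N #= `I_n)%card & p.[t%:R] = n%:R].

Section FullLatticePolytopes.
Context {R : realType}.

Lemma full_lattice_polytopeP {N} {P : set 'rV[R]_N} {p : {poly R}} : size p = N.+1 ->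
  full_lattice_polytope P p ->
  [/\ integral_polytope P, has_dim P N & ehrhart_polynomial P N p].
Proof.
move=> sp [[A [finA Aint affA PE]] cnt]; split; last by split.
- by rewrite PE; split; [exists A | move=> v /vertex_convex_hull/Aint].
- exists 0, fullv; split; last by rewrite dimvf /dim /= mul1n.
  apply/seteqP; split=> x _.
    by exists x; rewrite ?add0r //= memvf.
  have : setT x by []; rewrite -affA PE; apply: affine_hullS.
  exact: convex_hull_sub.
Qed.

(** The [t]-th dilate of [nP] is the [tn]-th dilate of [P], and the generators are scaled by [n]. *)
Lemma full_lattice_polytope_dilate {N} {P : set 'rV[R]_N} {p} (n : nat) :
  (0 < n)%N -> full_lattice_polytope P p ->
  full_lattice_polytope (dilate n P) (p \Po (n%:R *: 'X)).
Proof.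
move=> n0 [[A [finA Aint affA PE]] cnt].
have nN0 : n%:R != 0 :> R by rewrite pnatr_eq0 -lt0n.
split; last first.
  move=> t t0; have [|k ck pk] := cnt (t * n)%N; first by rewrite muln_gt0 t0.
  exists k; last by rewrite horner_comp !hornerE -natrM mulnC.
  suff -> : dilate t (dilate n P) = dilate (t * n) P by [].
  apply/seteqP; split=> x /=.
    by move=> [_ [y Py <-] <-]; exists y => //; rewrite natrM scalerA.
  by move=> [y Py <-]; exists (n%:R *: y); [exists y | rewrite natrM scalerA].
exists (dilate n A); split.
- exact: finite_image.
- move=> _ [x /Aint xint <-] /=; apply/mxOverP => i j; rewrite mxE.
  by rewrite rpredM ?rpred_nat //; exact: (mxOverP xint).
- apply/seteqP; split=> // x _.
  have : setT (n%:R^-1 *: x) by []; rewrite -affA => -[k [v [w [Av w1 xE]]]].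
  exists k, (fun i => n%:R *: v i), w; split=> // [i|]; first by exists (v i).
  rewrite -[LHS](scalerKV nN0) xE scaler_sumr.
  by apply: eq_bigr => i _; rewrite !scalerA mulrC.
- rewrite PE; apply/seteqP; split=> x /=.
    move=> [_ [k [v [w [Av w0 w1 ->]]]] <-].
    exists k, (fun i => n%:R *: v i), w; split=> // [i|]; first by exists (v i).
    by rewrite scaler_sumr; apply: eq_bigr => i _; rewrite !scalerA mulrC.
  move=> [k [v [w [Av w0 w1 ->]]]].
  exists (\sum_i w i *: (n%:R^-1 *: v i)).
    apply: convex_hull_fin => // i; have [y Ay <-] := Av i.
    by rewrite scalerA mulVf // scale1r.
  by rewrite scaler_sumr; apply: eq_bigr => i _; rewrite !scalerA mulrAC divff ?mul1r.
Qed.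

Lemma card_eq_II_range {I : finType} {T : Type} {S : set T} (f : I -> T) :
  injective f -> range f = S -> (S #= `I_#|I|)%card.
Proof.
move=> injf <-; apply: (@card_eq_trans _ _ _ _ [set: I]).
  by apply: inj_card_eq => x y _ _; exact: injf.
rewrite (card_eqr card_II); apply: card_esym.
rewrite card_eq_sym -(_ : enum_val @` [set: 'I_#|I|] = [set: I]).
  by apply: inj_card_eq => x y _ _; exact: enum_val_inj.
by apply/seteqP; split=> // x _; exists (enum_rank x); rewrite ?enum_rankK.
Qed.

Lemma card_eq_II_setX {T U : choiceType} {A : set T} {B : set U} {a b} :
  (A #= `I_a -> B #= `I_b -> A `*` B #= `I_(a * b))%card.
Proof.
move=> cA cB; have finA : finite_set A by apply/finite_setP; exists a.
have finB : finite_set B by apply/finite_setP; exists b.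
rewrite -(card_fset_set cA) -(card_fset_set cB) !cardfE -card_prod.
apply: (@card_eq_II_range _ _ _ (fun z => (fsval z.1, fsval z.2))).
  by move=> [x y] [x' y'] /= [/val_inj -> /val_inj ->].
apply/seteqP; split=> [_ [[x y] _ <-]|[x y] /= [Ax By]] /=.
  by split; apply/set_mem; rewrite -in_fset_set ?fsvalP.
have xA : x \in fset_set A by rewrite in_fset_set ?mem_set.
have yB : y \in fset_set B by rewrite in_fset_set ?mem_set.
by exists ([` xA]%fset, [` yB]%fset).
Qed.

Definition row_prod {N1 N2} (P : set 'rV[R]_N1) (Q : set 'rV[R]_N2) :
  set 'rV[R]_(N1 + N2) := [set row_mx x.1 x.2 | x in P `*` Q].

Lemma sum_row_mx {N1 N2} {I : finType} (f : I -> 'rV[R]_N1) (g : I -> 'rV[R]_N2) :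
  row_mx (\sum_i f i) (\sum_i g i) = \sum_i row_mx (f i) (g i).
Proof.
by elim/big_rec3: _ => [|i x y z _ <-]; rewrite ?row_mx0 // add_row_mx.
Qed.

(** The product weights [w i * w' j] have marginals [w] and [w']. *)
Lemma sum_row_mx_prod {N1 N2} {I J : finType} (v : I -> 'rV[R]_N1) w
    (v' : J -> 'rV[R]_N2) w' :
  \sum_i w i = 1 -> \sum_j w' j = 1 ->
  row_mx (\sum_i w i *: v i) (\sum_j w' j *: v' j) =
  \sum_(k : I * J) (w k.1 * w' k.2) *: row_mx (v k.1) (v' k.2).
Proof.
move=> w1 w1'; under [RHS]eq_bigr do rewrite scale_row_mx.
rewrite -sum_row_mx; congr row_mx.
  rewrite -(pair_bigA _ (fun i j => (w i * w' j) *: v i)) /=.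
  by apply: eq_bigr => i _; rewrite -scaler_suml -mulr_sumr w1' mulr1.
rewrite -(pair_bigA _ (fun i j => (w i * w' j) *: v' j)) exchange_big /=.
by apply: eq_bigr => j _; rewrite -scaler_suml -mulr_suml w1 mul1r.
Qed.

Lemma sum_prod1 {I J : finType} (w : I -> R) (w' : J -> R) :
  \sum_i w i = 1 -> \sum_j w' j = 1 -> \sum_(k : I * J) w k.1 * w' k.2 = 1.
Proof.
move=> w1 w1'; rewrite -(pair_bigA _ (fun i j => w i * w' j)) /=.
by under eq_bigr do rewrite -mulr_sumr w1' mulr1.
Qed.

Lemma full_lattice_polytope_prod {N1 N2} {P : set 'rV[R]_N1} {Q : set 'rV[R]_N2} {p q} :
  full_lattice_polytope P p -> full_lattice_polytope Q q ->
  full_lattice_polytope (row_prod P Q) (p * q).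
Proof.
move=> [[A [finA Aint affA PE]] cntP] [[B [finB Bint affB QE]] cntQ].
have intP x y : @integer_points R (N1 + N2) (row_mx x y) <->
    @integer_points R N1 x /\ @integer_points R N2 y.
  split=> [/mxOverP xy|[/mxOverP xint /mxOverP yint]].
    split; apply/mxOverP => i j.
      by have := xy i (lshift N2 j); rewrite row_mxEl.
    by have := xy i (rshift N1 j); rewrite row_mxEr.
  by apply/mxOverP => i j; rewrite mxE; case: fintype.splitP.
split; last first.
  move=> t t0; have [a ca pa] := cntP t t0; have [b cb qb] := cntQ t t0.
  exists (a * b)%N; last by rewrite hornerM pa qb natrM.
  apply: card_eq_trans (card_eq_II_setX ca cb).
  have -> : dilate t (row_prod P Q) `&` @integer_points R (N1 + N2) =
     (fun x => row_mx x.1 x.2) @`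
       ((dilate t P `&` @integer_points R N1) `*`
        (dilate t Q `&` @integer_points R N2)).
    apply/seteqP; split=> z /=.
      move=> [[_ [[x y] [/= Px Qy] <-]] <-]; rewrite scale_row_mx => /intP[xint yint].
      by exists (t%:R *: x, t%:R *: y) => //=; split; split=> //; [exists x|exists y].
    move=> [[_ _] [/= [[x Px <-] xint] [[y Qy <-] yint]] <-]; split; last exact/intP.
    by exists (row_mx x y); [exists (x, y) | rewrite scale_row_mx].
  apply: inj_card_eq => -[x y] [x' y'] _ _ /= /eq_row_mx[-> ->] //.
exists (row_prod A B); split.
- by apply: finite_image; exact: finite_setX.
- by move=> _ [[x y] [/= Ax By] <-]; apply/intP; split; [exact: Aint|exact: Bint].
- apply/seteqP; split=> // z _; rewrite -[z]hsubmxK.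
  have : setT (lsubmx z) by []; rewrite -affA => -[k [v [w [Av w1 ->]]]].
  have : setT (rsubmx z) by []; rewrite -affB => -[l [v' [w' [Bv' w1' ->]]]].
  rewrite sum_row_mx_prod //; apply: affine_hull_fin; last exact: sum_prod1.
  by move=> [i j] /=; exists (v i, v' j) => //; split; [exact: Av|exact: Bv'].
- rewrite PE QE; apply/seteqP; split=> z /=.
    move=> [[_ _] [/= [k [v [w [Av w0 w1 ->]]]] [l [v' [w' [Bv' w0' w1' ->]]]]] <-].
    rewrite /= sum_row_mx_prod //; apply: convex_hull_fin; last exact: sum_prod1.
  by move=> [i j] /=; exists (v i, v' j) => //; split; [exact: Av|exact: Bv'].
    by move=> [i j]; rewrite mulr_ge0.
  (* Conversely, a combination of pairs splits into two combinations with the same weights. *)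
  move=> [k [v [w [ABv w0 w1 ->]]]].
  have vE i : exists x, [/\ A x.1, B x.2 & v i = row_mx x.1 x.2].
    by have [x [Ax Bx] <-] := ABv i; exists x.
  have [f fP] := choice vE.
  exists (\sum_i w i *: (f i).1, \sum_i w i *: (f i).2).
    by split; apply: convex_hull_fin => // i; case: (fP i).
  rewrite /= sum_row_mx; apply: eq_bigr => i _; rewrite -scale_row_mx.
  by case: (fP i) => _ _ <-.
Qed.

End FullLatticePolytopes.

(** * Binomial polynomials and tuples of bounded sum *)

Section BinomialPolynomial.
Variable R : realType.

(* As a polynomial in t, this is the binomial coefficient (t + d - h choose d). *)
Definition binomial_poly (d h : nat) : {poly R} :=
  (d`!%:R)^-1 *: \prod_(i < d) ('X + (d%:R - h%:R - i%:R)%:P).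

Lemma natr_ffact (n d : nat) : \prod_(i < d) (n%:R - i%:R) = (n ^_ d)%:R :> R.
Proof.
elim: d => [|d IH]; first by rewrite big_ord0.
rewrite big_ord_recr /= IH ffactnSr natrM.
have [dn|nd] := leqP d n; first by rewrite natrB.
by rewrite ffact_small // !mul0r.
Qed.

(** The bound [h <= t + d] makes the truncated subtraction agree with subtraction in [R]; the
    product is then a falling factorial. *)
Lemma horner_binomial_poly (d h t : nat) : (h <= t + d)%N ->
  (binomial_poly d h).[t%:R] = 'C(t + d - h, d)%:R.
Proof.
move=> hle; rewrite /binomial_poly hornerZ horner_prod.
have -> : \prod_(i < d) ('X + (d%:R - h%:R - i%:R)%:P).[t%:R] =
    ((t + d - h) ^_ d)%:R :> R.
  rewrite -natr_ffact; apply: eq_bigr => i _.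
  by rewrite hornerD hornerX hornerC natrB // natrD; ring.
by rewrite -bin_ffact natrM mulrC mulfK // pnatr_eq0 -lt0n fact_gt0.
Qed.

End BinomialPolynomial.

(** Stars and bars. No entry exceeds the sum, so ['I_t.+1] admits the same tuples as ['I_s.+1]; this
    freedom lets one tuple type serve all the bounds [s = t - h_j]. *)
Lemma card_tuple_sum_le (d s t : nat) : (s <= t)%N ->
  #|[set c : d.-tuple 'I_t.+1 | (\sum_(i < d) tnth c i <= s)%N]%SET| = 'C(d + s, d).
Proof.
move=> st; rewrite -card_partial_ord_partitions.
have wid : (s.+1 <= t.+1)%N by [].
rewrite -(card_imset _ (_ : injective (map_tuple (widen_ord wid)))); last first.
  move=> c c' /(congr1 val) /= /inj_map cc'; apply: val_inj; apply: cc'.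
  by move=> i i' /(congr1 val) /= /val_inj.
apply: eq_card => c; rewrite inE; apply/idP/imsetP => [cs|[c' + ->]].
  exists [tuple inord (tnth c i) | i < d].
    rewrite inE big_tuple (leq_trans _ cs) //; apply: leq_sum => i _.
    by rewrite tnth_mktuple inordK // ltnS (leq_trans _ cs) // (bigD1 i) //= leq_addr.
  apply: eq_from_tnth => i; rewrite tnth_map tnth_mktuple; apply: val_inj => /=.
  by rewrite inordK // ltnS (leq_trans _ cs) // (bigD1 i) //= leq_addr.
rewrite inE big_tuple; apply: leq_trans; apply: leq_sum => i _.
by rewrite tnth_map.
Qed.

(** After division by [m], the integer [t - c] must be at least [s / m], hence at least its ceiling
    [(s + m.-1) %/ m]. *)
Lemma leq_add_ceil (m c s t : nat) : (0 < m)%N ->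
  (m * c + s <= t * m)%N = (c + (s + m.-1) %/ m <= t)%N.
Proof.
move=> m_gt0; have [ct|tc] := leqP c t.
  rewrite -(subnKC ct) leq_add2l -[RHS]ltnS ltn_divLR // mulnDl mulSn.
  by move: (t - c)%N => e; lia.
rewrite [RHS]leqNgt (leq_trans tc) ?leq_addr //=; apply/negbTE.
by rewrite -ltnNge (mulnC t) ltn_addr // ltn_pmul2l.
Qed.

(** * Lattice points in dilates of the cyclic simplex *)

Section CyclicSimplex.
Variables (R : realType) (n m : nat) (b : 'I_n.+1 -> nat).
Hypotheses (m_gt0 : (0 < m)%N) (b0 : b ord0 = 1%N).
Implicit Types (k l : 'I_n.+1) (x : 'rV[R]_n.+1) (t : nat).

Let mN0 : m%:R != 0 :> R. Proof. by rewrite pnatr_eq0 -lt0n. Qed.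
Let mR_gt0 : 0 < m%:R :> R. Proof. by rewrite ltr0n. Qed.

(* Vertices other than the origin: (m, -b_1, ..., -b_n), e_1, ..., e_n. *)
Definition cyclic_vertex k : 'rV[R]_n.+1 :=
  \row_l (if k == ord0 then if l == ord0 then m%:R else - (b l)%:R
          else (l == k)%:R).

Definition cyclic_simplex : set 'rV[R]_n.+1 :=
  convex_hull (0 |` range cyclic_vertex).

(* m times the barycentric coordinate of x at cyclic_vertex k; the convention
   b_0 = 1 makes the formula uniform in k. *)
Definition mbary k x : R := (b k)%:R * x 0 ord0 + (k != ord0)%:R * m%:R * x 0 k.

Lemma mbary_sum k (I : finType) (w : I -> R) (v : I -> 'rV[R]_n.+1) :
  mbary k (\sum_i w i *: v i) = \sum_i w i * mbary k (v i).
Proof.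
rewrite /mbary !summxE !mulr_sumr -big_split; apply: eq_bigr => i _ /=.
by rewrite !mxE; ring.
Qed.

Lemma mbaryZ k a x : mbary k (a *: x) = a * mbary k x.
Proof. by rewrite /mbary !mxE; ring. Qed.

Lemma mbary0 k : mbary k 0 = 0.
Proof. by rewrite /mbary !mxE !mulr0 addr0. Qed.

Lemma mbary_vertex k l : mbary k (cyclic_vertex l) = m%:R * (k == l)%:R.
Proof.
rewrite /mbary !mxE eqxx; have [->|k0] := eqVneq k ord0.
  by rewrite b0 mul1r !mul0r addr0 eq_sym; case: eqVneq; rewrite ?mulr1 ?mulr0.
have [->|l0] := eqVneq l ord0.
  by rewrite (negPf k0) mul1r mulr0 mulrN mulrC subrr.
by rewrite mul1r mulr0 add0r.
Qed.

Lemma mbary_sum_vertex k (w : 'I_n.+1 -> R) :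
  mbary k (\sum_l w l *: cyclic_vertex l) = m%:R * w k.
Proof.
rewrite mbary_sum (bigD1 k) //= mbary_vertex eqxx mulr1 big1 ?addr0 1?mulrC // => l lk.
by rewrite mbary_vertex eq_sym (negPf lk) !mulr0.
Qed.

(** Coordinate 0 comes from the first vertex alone, with weight [x_0 / m]. This subtracts
    [b_l x_0 / m] from coordinate [l], and the weight [x_l + b_l x_0 / m] of [e_l] compensates for
    it. *)
Lemma sum_mbary_vertex x : \sum_k (mbary k x / m%:R) *: cyclic_vertex k = x.
Proof.
apply/rowP => l; rewrite summxE (bigD1 ord0) //= !mxE /mbary !eqxx b0.
have [->|l0] := eqVneq l ord0.
  rewrite big1 => [|k k0]; first by rewrite mul1r !mul0r !addr0 divfK.
  by rewrite !mxE (negPf k0) eq_sym (negPf k0) mulr0.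
rewrite (bigD1 l) //= !mxE (negPf l0) eqxx big1 => [|k /andP[k0 kl]].
  by rewrite !mul1r mulr1; move: (b l)%:R (x 0 ord0) (x 0 l) => B x0 xl; field.
by rewrite !mxE (negPf k0) eq_sym (negPf kl) mulr0.
Qed.

Lemma mbary_inj x y : (forall k, mbary k x = mbary k y) -> x = y.
Proof.
move=> xy; rewrite -[x]sum_mbary_vertex -[y]sum_mbary_vertex.
by apply: eq_bigr => k _; rewrite xy.
Qed.

(* The origin is the vertex [None]. *)
Definition cyclic_weight x (o : option 'I_n.+1) : R :=
  if o is Some k then mbary k x / m%:R else 1 - \sum_k mbary k x / m%:R.

Lemma sum_option (V : zmodType) (F : option 'I_n.+1 -> V) :
  \sum_o F o = F None + \sum_k F (Some k).
Proof.
rewrite (bigD1 None) //=; congr (_ + _).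
rewrite (reindex_omap Some id) //=; last by case.
by apply: eq_bigl => k; rewrite eqxx.
Qed.

Lemma sum_cyclic_weight x : \sum_o cyclic_weight x o = 1.
Proof. by rewrite sum_option subrK. Qed.

Lemma cyclic_weightE x : x = \sum_o cyclic_weight x o *: oapp cyclic_vertex 0 o.
Proof. by rewrite sum_option /= scaler0 add0r sum_mbary_vertex. Qed.

Lemma oapp_cyclic_vertex o : (0 |` range cyclic_vertex) (oapp cyclic_vertex 0 o).
Proof. by case: o => [k|]; [right; exists k|left]. Qed.

(** All barycentric coordinates are nonnegative; the bound on the sum is this condition at the
    origin. *)
Lemma dilate_cyclic_simplex t x : (0 < t)%N ->
  dilate t cyclic_simplex x <->
  (forall k, 0 <= mbary k x) /\ \sum_k mbary k x <= (t * m)%:R.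
Proof.
move=> t_gt0; have tN0 : t%:R != 0 :> R by rewrite pnatr_eq0 -lt0n.
split=> [[_ [N [v [w [Av w0 w1 ->]]]] <-]|[x0 xle]].
  have bary0 k i : 0 <= mbary k (v i).
    case: (Av i) => [->|[l _ <-]]; first by rewrite mbary0.
    by rewrite mbary_vertex mulr_ge0.
  split=> [k|].
    by rewrite mbaryZ mbary_sum mulr_ge0 // sumr_ge0 // => i _; rewrite mulr_ge0.
  under eq_bigr do rewrite mbaryZ mbary_sum.
  rewrite -mulr_sumr exchange_big natrM ler_wpM2l //=.
  (* By linearity the bound is checked at the generators, where the sum of the [mbary k] is 0 at the
     origin and [m] at the other vertices. *)
  have -> : m%:R = \sum_i w i * m%:R by rewrite -mulr_suml w1 mul1r.
  apply: ler_sum => i _.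
  rewrite -mulr_sumr ler_wpM2l //; case: (Av i) => [->|[l _ <-]].
    by rewrite big1 // => k _; rewrite mbary0.
  rewrite (bigD1 l) //= big1 => [|k kl]; first by rewrite mbary_vertex eqxx addr0 mulr1.
  by rewrite mbary_vertex (negPf kl) mulr0.
exists (t%:R^-1 *: x); last by rewrite scalerKV.
rewrite [t%:R^-1 *: x]cyclic_weightE; apply: convex_hull_fin.
- exact: oapp_cyclic_vertex.
- move=> [k|] /=; first by rewrite divr_ge0 // mbaryZ mulr_ge0 ?invr_ge0.
  rewrite -mulr_suml; under eq_bigr do rewrite mbaryZ.
  rewrite -mulr_sumr subr_ge0 ler_pdivrMr // mul1r mulrC ler_pdivrMr ?ltr0n //.
  by rewrite -natrM mulnC.
- exact: sum_cyclic_weight.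
Qed.

Lemma affine_hull_cyclic_simplex : affine_hull (0 |` range cyclic_vertex) = setT.
Proof.
apply/seteqP; split=> // x _; rewrite [x]cyclic_weightE.
by apply: affine_hull_fin; [exact: oapp_cyclic_vertex|exact: sum_cyclic_weight].
Qed.

Lemma integer_points_cyclic_vertex :
  0 |` range cyclic_vertex `<=` @integer_points R n.+1.
Proof.
move=> _ [->|[k _ <-]] /=; apply/mxOverP => i l; rewrite mxE ?rpred0 //.
by do 2?case: ifP => _; rewrite ?rpredN ?rpred_nat.
Qed.

(* residue k j / m is the fractional part of the k-th barycentric coordinate of
   every lattice point x with x_0 = j modulo m. *)
Let residue k (j : nat) := ((b k * j) %% m)%N.

(** Here [x_0 = M_0], and [m x_k = M_k - b_k M_0] for the other coordinates, so integrality is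
    divisibility by [m]. *)
Lemma integer_points_mbary x (M : 'I_n.+1 -> nat) :
  (forall k, mbary k x = (M k)%:R) ->
  integer_points x <-> forall k, M k = b k * M ord0 %[mod m].
Proof.
move=> xM; have x0 : x 0 ord0 = (M ord0)%:R.
  by rewrite -xM /mbary b0 eqxx mul1r !mul0r addr0.
have xk k : k != ord0 -> m%:R * x 0 k = (M k)%:R - (b k * M ord0)%:R.
  by move=> k0; rewrite -xM /mbary k0 mul1r natrM x0 addrC addKr.
split=> [/mxOverP xint k|Mb].
  have [->|k0] := eqVneq k ord0; first by rewrite b0 mul1n.
  have /intrP[z zE] := xint 0 k; apply/eqP.
  have : (m %| (M k)%:Z - (b k * M ord0)%N%:Z)%Z.
    apply/dvdzP; exists z; apply: (@intr_inj R).
    by rewrite rmorphB intrM /= -!pmulrn -xk // zE mulrC.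
  by rewrite -eqz_mod_dvd !modz_nat eqz_nat.
apply/mxOverP => i k; rewrite ord1.
have [->|k0] := eqVneq k ord0; first by rewrite x0 rpred_nat.
suff -> : x 0 k = (M k %/ m)%:R - (b k * M ord0 %/ m)%:R by rewrite rpredB ?rpred_nat.
apply: (mulfI mN0); rewrite xk //.
have := congr1 (fun a => a%:R : R) (divn_eq (M k) m).
have := congr1 (fun a => a%:R : R) (divn_eq (b k * M ord0)%N m).
by rewrite -Mb !natrD !natrM => -> ->; ring.
Qed.

Definition cyclic_height (j : nat) : nat := ((\sum_k residue k j + m.-1) %/ m)%N.

(** [z] pairs a class [j] with the integral parts of the barycentric coordinates, whose sum is to be
    at most [t]; hence no part exceeds [t], and ['I_t.+1] has room for each. *)
Let bounded_parts {t} (z : 'I_m * n.+1.-tuple 'I_t.+1) :=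
  (\sum_k (m * tnth z.2 k + residue k z.1) <= t * m)%N.

Let part_point {t} (z : 'I_m * n.+1.-tuple 'I_t.+1) : 'rV[R]_n.+1 :=
  \sum_k ((m * tnth z.2 k + residue k z.1)%:R / m%:R) *: cyclic_vertex k.

Let mbary_part_point {t} (z : 'I_m * n.+1.-tuple 'I_t.+1) k :
  mbary k (part_point z) = (m * tnth z.2 k + residue k z.1)%:R.
Proof. by rewrite mbary_sum_vertex mulrC divfK. Qed.

Lemma residue_lt k j : (residue k j < m)%N. Proof. exact: ltn_pmod. Qed.

Lemma residue0 j : (j < m)%N -> residue ord0 j = j.
Proof. by move=> jm; rewrite /residue b0 mul1n modn_small. Qed.

(** Reduction modulo [m] gives the residues, the one at [ord0] being [j] itself because [b_0 = 1];
    the quotients by [m] then give [c]. *)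
Let part_point_inj t : injective (@part_point t).
Proof.
move=> [j c] [j' c'] eqp.
have E k : (m * tnth c k + residue k j = m * tnth c' k + residue k j')%N.
  have := congr1 (mbary k) eqp; rewrite !mbary_part_point => /eqP.
  by rewrite eqr_nat => /eqP.
have Er k : residue k j = residue k j'.
  rewrite -(modn_small (residue_lt k j)) -(modnMDl (tnth c k)) mulnC E.
  by rewrite mulnC modnMDl modn_small ?residue_lt.
have -> : j = j' by apply: val_inj; have := Er ord0; rewrite !residue0 ?ltn_ord.
congr (_, _); apply: eq_from_tnth => k; apply: val_inj => /=.
by apply/eqP; rewrite -(eqn_pmul2l m_gt0); have /eqP := E k; rewrite Er eqn_add2r.
Qed.

Lemma card_cyclic_simplex t : (0 < t)%N ->
  (dilate t cyclic_simplex `&` @integer_points R n.+1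
    #= `I_(#|[pred z : 'I_m * n.+1.-tuple 'I_t.+1 | bounded_parts z]|))%card.
Proof.
move=> t_gt0.
have -> : #|[pred z : 'I_m * n.+1.-tuple 'I_t.+1 | bounded_parts z]| =
    #|{: {z : 'I_m * n.+1.-tuple 'I_t.+1 | bounded_parts z}}|.
  by rewrite card_sig.
apply: (@card_eq_II_range _ _ _ (fun z => part_point (val z))).
  by move=> z z' /part_point_inj/val_inj.
apply/seteqP; split=> [_ [[z zP] _ <-]|x [xt xint]] /=.
  split.
    apply/dilate_cyclic_simplex => //; split=> [k|]; first by rewrite mbary_part_point.
    by under eq_bigr do rewrite mbary_part_point; rewrite -natr_sum ler_nat.
  pose M k := (m * tnth z.2 k + residue k z.1)%N.
  apply: (integer_points_mbary _ M (mbary_part_point z)).2 => k; rewrite /M.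
  rewrite residue0 // mulnC modnMDl /residue modn_mod mulnDr mulnCA -modnDml.
  by rewrite modnMr add0n.
have /dilate_cyclic_simplex-/(_ t_gt0)[x0 xle] := xt.
have Lint k : mbary k x \is a Num.nat.
  rewrite natrEint x0 andbT /mbary rpredD ?rpredM ?rpred_nat //; exact: (mxOverP xint).
have [M xM] : exists M : 'I_n.+1 -> nat, forall k, mbary k x = (M k)%:R.
  by have [M MP] := choice (fun k => natrP (Lint k)); exists M.
have Mb := (integer_points_mbary x M xM).1 xint.
have Mle : (\sum_k M k <= t * m)%N.
  by rewrite -(ler_nat R) natr_sum; under eq_bigr do rewrite -xM.
have ct k : (M k %/ m < t.+1)%N.
  rewrite ltnS -[leqRHS](mulnK t m_gt0) leq_div2r // (leq_trans _ Mle) //.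
  by rewrite (bigD1 k) //= leq_addr.
(* Division by [m] inverts [part_point]: the congruences [Mb] say that the remainder of each [M k]
   is the residue of the class of [M ord0]. *)
pose z := (Ordinal (ltn_pmod (M ord0) m_gt0), [tuple Ordinal (ct k) | k < n.+1]).
have ME k : (m * tnth z.2 k + residue k z.1)%N = M k.
  by rewrite tnth_mktuple /= /residue modnMmr -Mb mulnC -divn_eq.
have zP : bounded_parts z by rewrite /bounded_parts; under eq_bigr do rewrite ME.
exists (Sub z zP) => //=; apply: mbary_inj => k.
by rewrite mbary_part_point ME xM.
Qed.

Lemma cyclic_height_le j : (cyclic_height j <= n.+1)%N.
Proof.
rewrite -ltnS /cyclic_height ltn_divLR // mulSn.
have : (\sum_k residue k j <= n.+1 * m)%N.
  rewrite -[n.+1 in leqRHS]card_ord -sum_nat_const; apply: leq_sum => k _.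
  by rewrite ltnW ?residue_lt.
by move=> H; rewrite addnC -addSn prednK // leq_add2l.
Qed.

Lemma card_bounded_parts t :
  #|[pred z : 'I_m * n.+1.-tuple 'I_t.+1 | bounded_parts z]| =
  (\sum_(j < m) 'C(t + n.+1 - cyclic_height j, n.+1))%N.
Proof.
rewrite -sum1_card (eq_bigl (fun z => true && bounded_parts (z.1, z.2))); last by case.
rewrite -(pair_big_dep xpredT (fun j c => bounded_parts (j, c)) (fun _ _ => 1%N)) /=.
apply: eq_bigr => j _; rewrite sum1dep_card.
have bE (c : n.+1.-tuple 'I_t.+1) :
    bounded_parts (j, c) = (\sum_k tnth c k + cyclic_height j <= t)%N.
  rewrite /bounded_parts big_split /= -big_distrr /= /cyclic_height.
  by rewrite leq_add_ceil.
(* If the height exceeds [t], no tuple qualifies, and the binomial coefficient vanishes since its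
   upper entry is below [n.+1]. *)
have [hle|hgt] := leqP (cyclic_height j) t; last first.
  rewrite bin_small; last by have := cyclic_height_le j; lia.
  apply/eqP; rewrite cards_eq0; apply/eqP/setP => c; rewrite !inE bE.
  by apply/negbTE; rewrite -ltnNge (leq_trans hgt) // leq_addl.
rewrite -addnBAC // addnC -(card_tuple_sum_le _ _ _ (leq_subr (cyclic_height j) t)).
by apply: eq_card => c; rewrite !inE bE leq_subRL // addnC.
Qed.

Definition cyclic_poly : {poly R} :=
  \sum_(j < m) binomial_poly R n.+1 (cyclic_height j).

Lemma full_lattice_polytope_cyclic : full_lattice_polytope cyclic_simplex cyclic_poly.
Proof.
split.
  exists (0 |` range cyclic_vertex); split=> //.
  - by rewrite finite_setU; split; [exact: finite_set1|exact: finite_image].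
  - exact: integer_points_cyclic_vertex.
  - exact: affine_hull_cyclic_simplex.
move=> t t_gt0; eexists; first exact: card_cyclic_simplex.
rewrite card_bounded_parts natr_sum horner_sum; apply: eq_bigr => j _.
by rewrite horner_binomial_poly // (leq_trans (cyclic_height_le j)) // leq_addl.
Qed.

End CyclicSimplex.

(** * Integer arithmetic of the coefficients and the table of signs *)

(** Polynomials are lists of binary integers, constant term first, so that the table can be checked
    by evaluation. *)
Fixpoint Zpoly_add (p q : seq Z) : seq Z :=
  match p, q with
  | [::], _ => q
  | _, [::] => p
  | a :: p', c :: q' => Z.add a c :: Zpoly_add p' q'
  end.

Fixpoint Zpoly_mul (p q : seq Z) : seq Z :=
  if p is a :: p' then Zpoly_add (map (Z.mul a) q) (Z0 :: Zpoly_mul p' q) else [::].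

(* d! times (nt + d - h choose d), as a polynomial in t. *)
Definition Zbinomial (d n h : nat) : seq Z :=
  foldr (fun i => Zpoly_mul
      [:: Z.sub (Z.sub (Z.of_nat d) (Z.of_nat h)) (Z.of_nat i); Z.of_nat n])
    [:: Zpos xH] (iota 0 d).

(** Evaluable form of [cyclic_height] for the classes [j < m]; the [1] put before [bs] is [b_0]. *)
Definition heights (m : nat) (bs : seq nat) : seq nat :=
  [seq ((sumn [seq (x * j) %% m | x <- 1 :: bs] + m.-1) %/ m)%N | j <- iota 0 m].

(** With [d = (size bs).+1], this is [d!] times the Ehrhart polynomial of the [n]-th dilate; the
    factor clears the denominators. *)
Definition Zcyclic (n m : nat) (bs : seq nat) : seq Z :=
  foldr (fun h => Zpoly_add (Zbinomial (size bs).+1 n h)) [::] (heights m bs).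

(* For given signs s_1, ..., s_5 of the coefficients of t, ..., t^5 (true meaning
   negative), the entry (m, n, m', n', b') with number s_1 + 2 s_2 + ... + 16 s_5
   stands for the product of n times the Reeve tetrahedron cyclic_simplex with
   parameters m and (1, m - 1, 1) and n' times the 4-dimensional cyclic_simplex
   with parameters m' and (1, b').  The entries were found by a computer search. *)
Definition sign_table : seq (nat * nat * nat * nat * seq nat) := ([::
  (1, 1, 1, 1, [:: 0; 0; 0]);
  (13, 26, 1, 2, [:: 0; 0; 0]);
  (19, 4, 1, 3, [:: 0; 0; 0]);
  (20, 4, 1, 2, [:: 0; 0; 0]);
  (22, 1, 1, 3, [:: 0; 0; 0]);
  (25, 3, 14, 3, [:: 1; 1; 1]);
  (23, 5, 1, 11, [:: 0; 0; 0]);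
  (31, 2, 1, 3, [:: 0; 0; 0]);
  (22, 1, 1, 9, [:: 0; 0; 0]);
  (23, 3, 15, 5, [:: 0; 1; 14]);
  (27, 1, 6, 3, [:: 0; 5; 1]);
  (25, 12, 13, 22, [:: 4; 12; 0]);
  (24, 3, 1, 16, [:: 0; 0; 0]);
  (34, 11, 20, 26, [:: 8; 0; 19]);
  (30, 2, 1, 8, [:: 0; 0; 0]);
  (33, 7, 7, 15, [:: 6; 4; 0]);
  (13, 1, 1, 79, [:: 0; 0; 0]);
  (13, 1, 26, 15, [:: 0; 21; 25]);
  (23, 1, 9, 3, [:: 4; 4; 8]);
  (31, 1, 14, 2, [:: 13; 7; 1]);
  (21, 1, 5, 6, [:: 1; 1; 1]);
  (41, 2, 21, 5, [:: 11; 1; 11]);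
  (25, 4, 7, 13, [:: 2; 2; 4]);
  (35, 7, 10, 16, [:: 7; 4; 3]);
  (22, 2, 1, 25, [:: 0; 0; 0]);
  (21, 2, 19, 5, [:: 18; 1; 0]);
  (28, 1, 9, 3, [:: 5; 4; 0]);
  (28, 6, 13, 14, [:: 11; 0; 2]);
  (29, 1, 2, 7, [:: 1; 0; 1]);
  (35, 2, 20, 5, [:: 16; 19; 0]);
  (31, 2, 4, 9, [:: 2; 3; 1]);
  (35, 3, 9, 8, [:: 0; 2; 8])])%N.

Definition sign_index (s : seq bool) : nat :=
  foldr (fun (e : bool) i => (e + i.*2)%N) 0%N s.

Definition table_poly (c : nat * nat * nat * nat * seq nat) : seq Z :=
  let: (m, n, m', n', b') := c in
  Zpoly_mul (Zcyclic n m [:: m.-1; 1]%N) (Zcyclic n' m' b').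

(** The list [s] concerns [t] to [t^5]; the [false] entries around it demand a positive constant
    term and positive coefficients of [t^6] and [t^7]. *)
Definition sign_ok (s : seq bool) : bool :=
  let c := nth (1, 1, 1, 1, [:: 0; 0; 0])%N sign_table (sign_index s) in
  let: (m, n, m', n', b') := c in
  [&& (0 < m)%N, (0 < n)%N, (0 < m')%N, (0 < n')%N, size b' == 3,
      size (table_poly c) == 8 &
      all2 (fun a (neg : bool) => if neg then Z.ltb a Z0 else Z.ltb Z0 a)
        (table_poly c) (false :: s ++ [:: false; false])].

Lemma sign_okT (s1 s2 s3 s4 s5 : bool) : sign_ok [:: s1; s2; s3; s4; s5].
Proof. by move: s1 s2 s3 s4 s5; do 5![case]; vm_compute. Qed.

(** * From integer lists to real polynomials *)

Section ZPolynomials.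
Variable R : realType.

Definition Zreal (z : Z) : R := (int_of_Z z)%:~R.
Definition Zpoly (p : seq Z) : {poly R} := Poly (map Zreal p).

Lemma ZrealD a c : Zreal (Z.add a c) = Zreal a + Zreal c.
Proof. by rewrite /Zreal -intrD; congr (_%:~R); lia. Qed.

Lemma ZrealM a c : Zreal (Z.mul a c) = Zreal a * Zreal c.
Proof. by rewrite /Zreal -intrM; congr (_%:~R); lia. Qed.

Lemma Zreal_nat n : Zreal (Z.of_nat n) = n%:R.
Proof. by rewrite /Zreal pmulrn; congr (_%:~R); lia. Qed.

Lemma ZrealB a c : Zreal (Z.sub a c) = Zreal a - Zreal c.
Proof. by rewrite /Zreal -intrB; congr (_%:~R); lia. Qed.

Lemma Zreal_lt0 a : Z.ltb a Z0 -> Zreal a < 0.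
Proof. by move=> a0; rewrite ltrz0; lia. Qed.

Lemma Zreal_gt0 a : Z.ltb Z0 a -> 0 < Zreal a.
Proof. by move=> a0; rewrite ltr0z; lia. Qed.

Lemma Zpoly_cons a p : Zpoly (a :: p) = (Zreal a)%:P + 'X * Zpoly p.
Proof. by rewrite /Zpoly /= cons_poly_def addrC mulrC. Qed.

Lemma Zpoly_nil : Zpoly [::] = 0. Proof. by []. Qed.

Lemma Zpoly_addE p q : Zpoly (Zpoly_add p q) = Zpoly p + Zpoly q.
Proof.
elim: p q => [|a p IH] [|c q] /=; rewrite ?Zpoly_nil ?add0r ?addr0 //.
by rewrite !Zpoly_cons IH ZrealD polyCD; ring.
Qed.

Lemma Zpoly_mulE p q : Zpoly (Zpoly_mul p q) = Zpoly p * Zpoly q.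
Proof.
elim: p => [|a p IH] /=; rewrite ?Zpoly_nil ?mul0r //.
rewrite Zpoly_addE !Zpoly_cons IH (_ : Zreal Z0 = 0) // polyC0 add0r.
rewrite mulrDl mulrA; congr (_ + _).
elim: q {IH} => [|c q IHq]; rewrite ?Zpoly_nil ?mulr0 //= !Zpoly_cons IHq ZrealM polyCM.
by ring.
Qed.

Lemma ZbinomialE d n h :
  (d`!%:R)^-1 *: Zpoly (Zbinomial d n h) = binomial_poly R d h \Po (n%:R *: 'X).
Proof.
rewrite /binomial_poly comp_polyZ; congr (_ *: _).
rewrite rmorph_prod /Zbinomial -(big_mkord xpredT
  (fun i => ('X + (d%:R - h%:R - i%:R)%:P) \Po (n%:R *: 'X))) /index_iota subn0.
elim: (iota 0 d) => [|i s IH].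
  by rewrite big_nil Zpoly_cons Zpoly_nil mulr0 addr0.
rewrite big_cons -IH.
rewrite (_ : _ \Po _ = Zpoly
  [:: Z.sub (Z.sub (Z.of_nat d) (Z.of_nat h)) (Z.of_nat i); Z.of_nat n]).
  by rewrite -Zpoly_mulE.
rewrite comp_polyD comp_polyX comp_polyC !Zpoly_cons Zpoly_nil mulr0 addr0 addrC.
by rewrite !ZrealB !Zreal_nat -mul_polyC mulrC.
Qed.

Lemma ZcyclicE n m bs : (0 < m)%N ->
  ((size bs).+1`!%:R)^-1 *: Zpoly (Zcyclic n m bs) =
  cyclic_poly R (size bs) m (fun k => nth 0%N (1%N :: bs) k) \Po (n%:R *: 'X).
Proof.
move=> m_gt0; rewrite /cyclic_poly rmorph_sum /Zcyclic /heights.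
under [RHS]eq_bigr do rewrite /= -ZbinomialE.
rewrite -scaler_sumr; congr (_ *: _).
rewrite -(big_mkord xpredT (fun j => Zpoly (Zbinomial _ n (cyclic_height _ _ _ j)))).
rewrite /index_iota subn0; elim: (iota 0 m) => [|j s IH] /=; first by rewrite big_nil.
rewrite big_cons -IH Zpoly_addE; congr (Zpoly (Zbinomial _ _ _) + _).
rewrite /cyclic_height; congr ((_ + _) %/ _)%N.
(* Puts the simplified term of [b_0] back into the list. *)
rewrite -[LHS]/(sumn [seq (x * j) %% m | x <- 1%N :: bs])%N.
by rewrite sumnE big_map (big_nth 0%N) big_mkord.
Qed.

End ZPolynomials.

(** * The polytope with prescribed signs *)

Lemma all2_nth {T U : Type} {r : T -> U -> bool} (x : T) (y : U) {s t k} :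
  all2 r s t -> (k < size s)%N -> r (nth x s k) (nth y t k).
Proof.
elim: s t k => [|a s IH] [|c t] //= [|k] /andP[rac /IH st] //.
exact: st.
Qed.

Theorem theorem5p2 (R : realType) (q : nat) (i : 'I_q -> nat)
    (q_ge1 : (1 <= q)%N)
    (i_range : forall j : 'I_q, (1 <= i j <= 5)%N)
    (i_incr : forall j k : 'I_q, (j < k)%N -> (i j < i k)%N) :
  exists (N : nat) (P : set 'rV[R]_N) (p : {poly R}),
    [/\ integral_polytope P, has_dim P 7, ehrhart_polynomial P 7 p,
        forall j : 'I_q, p`_(i j) < 0
      & forall k : nat, (k <= 7)%N -> (forall j : 'I_q, k <> i j) -> 0 < p`_k].
Proof.
pose S k := [exists j, i j == k].
have S_range k : S k -> (1 <= k <= 5)%N by case/existsP => j /eqP <-.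
have := sign_okT (S 1) (S 2) (S 3) (S 4) (S 5); rewrite /sign_ok.
case: (nth _ _ _) => [[[[m n] m'] n'] b'].
move=> /and5P[m_gt0 n_gt0 m'_gt0 n'_gt0 /and3P[sb' /eqP sz signs]].
case: b' sb' sz signs => [|b1[|b2[|b3[|]]]] // _.
set b' := [:: b1; b2; b3]; set l := table_poly _ => sz signs.
have signs_nth k : (k <= 7)%N ->
    if S k then Zreal R (nth Z0 l k) < 0 else 0 < Zreal R (nth Z0 l k).
  move=> k7; have := all2_nth Z0 false signs (_ : k < size l)%N.
  rewrite sz ltnS => /(_ k7); set neg := nth false _ _.
  have -> : neg = S k.
    (* The exponents 0, 6 and 7 lie outside the range of [i], in accordance with the [false]
       entries. *)
    rewrite /neg; case: k k7 {neg} => [|[|[|[|[|[|[|[|]]]]]]]] //= _;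
      by apply/esym/negbTE/negP => /S_range.
  by case: ifP => _; [exact: Zreal_lt0|exact: Zreal_gt0].
(* [c] undoes the factors [3!] and [4!] by which the integer lists were scaled. *)
pose c : R := (3`!%:R)^-1 * (4`!%:R)^-1.
have c_gt0 : 0 < c by rewrite mulr_gt0 // invr_gt0 ltr0n fact_gt0.
(* These parameters give the Reeve tetrahedron. The arguments 2 and 3 below are one less than the
   dimensions 3 and 4. *)
pose b := nth 0%N [:: 1; m.-1; 1]%N.
pose simplex3 := full_lattice_polytope_dilate n n_gt0
  (full_lattice_polytope_cyclic R 2 m b m_gt0 erefl).
pose simplex4 := full_lattice_polytope_dilate n' n'_gt0
  (full_lattice_polytope_cyclic R 3 m' (nth 0%N (1%N :: b')) m'_gt0 erefl).
have := full_lattice_polytope_prod simplex3 simplex4.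
set P := row_prod _ _; set p := _ * _ => Pp.
have pE : p = c *: Zpoly R l.
  rewrite /p /l /table_poly Zpoly_mulE /c -scalerA scalerAr scalerAl.
  by rewrite -(ZcyclicE R n m [:: m.-1; 1]%N) // -(ZcyclicE R n' m' b').
have coef_p k : (k <= 7)%N -> p`_k = c * Zreal R (nth Z0 l k).
  by move=> k7; rewrite pE coefZ coef_Poly (nth_map Z0) ?sz.
have size_p : size p = 8.
  apply/eqP; rewrite eqn_leq; apply/andP; split.
    rewrite pE (leq_trans (size_scale_leq _ _)) // (leq_trans (size_Poly _)) //.
    by rewrite size_map sz.
  (* The degree is not less than 7: 7 is not a prescribed exponent, so the coefficient of [t^7] is
     positive. *)
  rewrite ltnNge; apply/negP => /leq_sizeP/(_ 7 (leqnn _))/eqP.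
  rewrite coef_p // mulf_eq0 (gt_eqF c_gt0) /=; have := signs_nth 7 (leqnn _).
  by case: ifP => [/S_range//|_ /gt_eqF->].
have [P_int P_dim P_ehr] := full_lattice_polytopeP size_p Pp.
exists 7, P, p; split=> // [j|k k7 ki].
  have Sij : S (i j) by apply/existsP; exists j.
  have ij7 : (i j <= 7)%N by have /andP[_ /leq_trans->] := i_range j.
  by rewrite coef_p // pmulr_rlt0 //; have := signs_nth _ ij7; rewrite Sij.
rewrite coef_p // pmulr_rgt0 //; have := signs_nth _ k7.
by case: ifP => // /existsP[j /eqP]/esym/ki.
Qed.
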